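(* For any Hausdorff space $X$, we have $so_{\chi}(X)=so_{\chi}(\mathcal{S}(X))$.
   Context: For a Hausdorff space $X$, $\mathcal{S}(X)$ is the set of all nonempty subsets of $X$ that are unions of finitely many convergent sequences of $X$, where a convergent sequence is understood as a set $\{x_j:j\in\mathbb{N}\}\cup\{x\}$ with $x_j\to x$ in $X$ (trivial, i.e. constant, sequences allowed). $\mathcal{S}(X)$ carries the Vietoris topology, whose basic open sets are $\langle U_1,\dots,U_r\rangle=\{S\in\mathcal{S}(X): S\subset\bigcup_{i=1}^r U_i \text{ and } S\cap U_j\neq\emptyset \text{ for } 1\le j\le r\}$ with $r\in\mathbb{N}$ and $U_1,\dots,U_r$ open in $X$. Let $Y$ be a space. A subset $P\subset Y$ is a sequential neighborhood of $y\in Y$ if $y\in P$ and each sequence converging to $y$ is eventually in $P$; $P$ is sequentially open if it is a sequential neighborhood of each of its points. An so-network at a point $y\in Y$ is a family $\mathcal{P}_y$ of sequentially open sets containing $y$ such that (a) for all $U,V\in\mathcal{P}_y$ there is $W\in\mathcal{P}_y$ with $W\subset U\cap V$, and (b) for each open neighborhood $U$ of $y$ there is $P\in\mathcal{P}_y$ with $y\in P\subset U$. The smallest size of an so-network at $y$ is denoted $so_{\chi}(Y,y)$, and $so_{\chi}(Y)=\sup_{y\in Y}so_{\chi}(Y,y)$ (with $so_{\chi}(\emptyset)=1$). *)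

(* Defs.v *)
From HB Require Import structures.
From mathcomp Require Import all_boot all_classical.
From mathcomp Require Import topology.

Set Implicit Arguments.
Unset Strict Implicit.
Unset Printing Implicit Defensive.

Local Open Scope classical_set_scope.
Local Open Scope card_scope.

(* Cardinals are represented by sets, compared with #<= and #=.  As cardinals
   are well-ordered, a nonempty family F has a member of smallest cardinality;
   card_min F is one, so its cardinality is the minimum of the cardinalities of
   the members of F (see card_minP). *)
Definition card_min {T : Type} (F : set (set T)) : set T :=
  get [set A | F A /\ forall B, F B -> A #<= B].

Lemma card_minP (T : Type) (F : set (set T)) : F !=set0 ->
  F (card_min F) /\ forall B, F B -> card_min F #<= B.
Proof.
move=> [A0 FA0].
suff exm : exists A, [set A | F A /\ forall B, F B -> A #<= B] A.
  exact: (getPex exm).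
(* Take a maximal set Z of choice functions of F that are pairwise distinct at
   each member of F; evaluation at some A in F is then onto A, while at each B
   in F it is an injection into B. *)
pose good (Z : set (set T -> T)) := forall A, F A ->
  (forall f, Z f -> A (f A)) /\
  (forall f g, Z f -> Z g -> f A = g A -> f = g).
have [|Z [goodZ maxZ]] := @Zorn_bigcup _ good.
  move=> C Cgood totC A FA; split=> [f [Z CZ Zf]|f g [Z CZ Zf] [Y CY Yg] fg].
    by have [+ _] := Cgood _ CZ A FA; exact.
  have [ZY|YZ] := totC _ _ CZ CY.
    by have [_ inj] := Cgood _ CY A FA; apply: inj => //; exact: ZY.
  by have [_ inj] := Cgood _ CZ A FA; apply: inj => //; exact: YZ.
have [[A FA sur]|nsur] :=
    pselect (exists2 A, F A & A `<=` [set f A | f in Z]).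
  exists A; split=> // B FB.
  apply: card_le_trans (subset_card_le sur) _.
  apply: card_le_trans (card_image_le _ _) _.
  have injB : {in Z &, injective (fun f : set T -> T => f B)}.
    move=> f g /set_mem Zf /set_mem Zg.
    by have [_ inj] := goodZ B FB; exact: inj.
  rewrite -(card_le_eql (inj_card_eq injB)); apply: subset_card_le.
  by move=> _ [f Zf <-]; have [+ _] := goodZ B FB; exact.
have new A : exists a, F A -> A a /\ ~ [set f A | f in Z] a.
  have [FA|nFA] := pselect (F A); last first.
    have [a _] : A0 !=set0.
      apply: contrapT => A0n; apply: nsur; exists A0 => // a A0a.
      by case: A0n; exists a.
    by exists a.
  apply: contrapT => nA; apply: nsur; exists A => // a Aa.
  by apply: contrapT => na; apply: nA; exists a.
have [h hP] := choice new.
exfalso; apply: (maxZ (Z `|` [set h])).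
  split; first by move=> f Zf; left.
  move=> /(_ h (or_intror erefl)) Zh.
  by have [_] := hP A0 FA0; apply; exists h.
move=> A FA; have [memA injA] := goodZ A FA; have [hA nhA] := hP A FA.
split=> [f [/memA//|->//]|f g [Zf|->] [Zg|->] fg //].
- exact: injA.
- by case: nhA; exists f.
- by case: nhA; exists g.
Qed.

Section so_character.
Variable Y : topologicalType.
Implicit Types (y : Y) (P U V W : set Y) (N : set (set Y)).

Definition seq_nbhd P y : Prop :=
  P y /\ forall u : nat -> Y, u @ \oo --> y -> \forall n \near \oo, P (u n).

Definition seq_open P : Prop := forall y, P y -> seq_nbhd P y.

Definition so_network y N : Prop :=
  [/\ forall P, N P -> seq_open P /\ P y,
      forall U V, N U -> N V -> exists2 W, N W & W `<=` U `&` V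
    & forall U, open U -> U y -> exists2 P, N P & P `<=` U].

Definition so_char_at y : set (set Y) := card_min (so_network y).

(* The condition C !=set0 is implied by the second one as soon as Y has a point
   (an so-network is nonempty): it only encodes the value 1 for empty Y.  The
   supremum is at most the cardinality of set Y, hence the type of C. *)
Definition so_char : set (set Y) :=
  card_min [set C : set (set Y) |
    C !=set0 /\ forall y, so_char_at y #<= C].

Lemma so_char_atP y : so_network y (so_char_at y) /\
  forall N, so_network y N -> so_char_at y #<= N.
Proof.
apply: card_minP; exists [set P | open P /\ P y]; split.
- move=> P [oP Py]; split=> // z Pz; split=> // u uz.
  by apply: uz; apply: open_nbhs_nbhs.
- move=> U V [oU Uy] [oV Vy]; exists (U `&` V) => //.
  by split; [exact: openI|split].
- by move=> U oU Uy; exists U.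
Qed.

Lemma so_charP :
  [/\ so_char !=set0, forall y, so_char_at y #<= so_char
    & forall C : set (set Y), C !=set0 ->
        (forall y, so_char_at y #<= C) -> so_char #<= C].
Proof.
have [|[so0 sole] somin] := @card_minP _ [set C : set (set Y) |
    C !=set0 /\ forall y, so_char_at y #<= C].
  exists setT; split; first by exists setT.
  by move=> y; exact: card_leT.
by split=> // C C0 Cle; apply: somin.
Qed.

End so_character.

Arguments so_char Y : clear implicits.

Section convergent_sequences.
Variable X : topologicalType.

Definition convergent_sequence (A : set X) : Prop :=
  exists (u : nat -> X) (x : X), u @ \oo --> x /\ A = range u `|` [set x].

Definition fin_union_convergent_sequences (S : set X) : Prop :=
  exists (n : nat) (A : 'I_n -> set X),
    (forall i, convergent_sequence (A i)) /\ S = \bigcup_i A i.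

Record seqhyper : Type := SeqHyper {
  seqhyper_set :> set X;
  seqhyper_neq0 : seqhyper_set !=set0;
  seqhyper_fin : fin_union_convergent_sequences seqhyper_set }.

HB.instance Definition _ := gen_eqMixin seqhyper.
HB.instance Definition _ := gen_choiceMixin seqhyper.

Definition vietoris (r : nat) (U : 'I_r -> set X) : set seqhyper :=
  [set S : seqhyper | S `<=` \bigcup_i U i /\ forall j, (S `&` U j) !=set0].

Definition vietoris_base : set (set seqhyper) :=
  [set B | exists (r : nat) (U : 'I_r -> set X),
    (forall i, open (U i)) /\ B = vietoris U].

Lemma vietoris_base_cover : \bigcup_(B in vietoris_base) B = setT.
Proof.
rewrite -subTset => S _.
exists (vietoris (fun _ : 'I_1 => setT)).
  by exists 1%N, (fun=> setT); split=> // _; exact: openT.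
have [x Sx] := seqhyper_neq0 S.
by split=> /= [y _|_]; [exists ord0 | exists x].
Qed.

Lemma vietoris_base_join (B C : set seqhyper) (S : seqhyper) :
  vietoris_base B -> vietoris_base C -> B S -> C S ->
  exists D, [/\ vietoris_base D, D S & D `<=` B `&` C].
Proof.
move=> [r [U [oU ->]]] [s [V [oV ->]]] [SU SUj] [SV SVj].
pose W (i : 'I_(r + s)) := match fintype.split i with
  | inl j => U j `&` \bigcup_k V k
  | inr k => V k `&` \bigcup_j U j end.
have Wl j : W (lshift s j) = U j `&` \bigcup_k V k.
  by rewrite /W -[lshift s j]/(unsplit (inl j)) unsplitK.
have Wr k : W (rshift r k) = V k `&` \bigcup_j U j.
  by rewrite /W -[rshift r k]/(unsplit (inr k)) unsplitK.
exists (vietoris W); split.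
- exists (r + s)%N, W; split=> // i; rewrite /W.
  by case: (fintype.split i) => j; apply: openI => //; exact: bigcup_open.
- split=> [x Sx|i].
    have [j _ Ujx] := SU _ Sx.
    by exists (lshift s j) => //; rewrite Wl; split=> //; exact: SV.
  rewrite /W; case: (fintype.split i) => j.
    have [x [Sx Ujx]] := SUj j.
    by exists x; split=> //; split=> //; exact: SV.
  have [x [Sx Vjx]] := SVj j.
  by exists x; split=> //; split=> //; exact: SU.
- move=> T [TW TWi].
  have TWsub x : (T : set X) x -> (\bigcup_j U j) x /\ (\bigcup_k V k) x.
    move=> /TW [i _]; rewrite /W; case: (fintype.split i) => j [h1 h2].
      by split=> //; exists j.
    by split=> //; exists j.
  split; split.
  + by move=> x /TWsub [].
  + by move=> j; have [x [Tx]] := TWi (lshift s j); rewrite Wl => -[? _]; exists x.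
  + by move=> x /TWsub [].
  + by move=> k; have [x [Tx]] := TWi (rshift r k); rewrite Wr => -[? _]; exists x.
Qed.

HB.instance Definition _ := isBaseTopological.Build seqhyper
  vietoris_base_cover vietoris_base_join.

End convergent_sequences.

(* Main.v *)
Require Import Defs.
From mathcomp Require Import all_boot all_classical topology.

(** Write kappa for the so-character of X.

    The map x |-> {x} from X to S(X) is continuous, and the preimage of a
    sequentially open set under a continuous map is sequentially open.  So an
    so-network at {x} pulls back to one at x which is not larger: this gives
    so_char X <= so_char S(X), in [so_char_at_seqhyper1].

    For the converse, fix S in S(X) and, at each point a of S, an so-network
    N_a of smallest size.  Two facts about S(X) make the Vietoris sets
      <W_1, ..., W_r>,  with each W_i in some N_a and S in <W_1, ..., W_r>,
    a local network at S made of sequentially open sets.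
    - They refine the neighbourhoods of S, because a finite union of convergent
      sequences is compact even for covers by sequential neighbourhoods: a
      sequential neighbourhood of the limit contains a tail of the sequence
      ([fin_union_seqs_finite_cover], [vietoris_of_refine]).
    - <W_1, ..., W_r> is sequentially open whenever the W_i are.  The point is
      that if S_n converges to S and t is in S, then t can be reached by a
      genuine sequence of points of the S_n as soon as the S_n meet every
      neighbourhood of t infinitely often, although X need not be first
      countable: S is countable, so countably many open sets separate t from
      the rest of S, and compactness of S does what a countable base at t would
      do ([seq_open_avoid], [seq_open_vietoris_of]).
    These sets need not be directed, since N_b need not contain a set inside
    W_i when b is in W_i; so the network at S is made of their finite
    intersections.

    It remains to count.  S is countable, so for infinite kappa the union of the
    N_a has at most kappa elements, and so do its finite subsets and the finite
    sets of these; this rests on the fact that an infinite set has as many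
    finite sequences as elements ([card_nseqs_infinite]).  If kappa is finite,
    each N_a has a smallest element, which is {a} because X is Hausdorff.  Then
    all the {a} are sequentially open, the W_i can be taken of this form, and
    {S} itself is sequentially open, so that one set is enough at S
    ([so_char_at_seqhyper_le]). *)

Set Implicit Arguments.
Unset Strict Implicit.
Unset Printing Implicit Defensive.

Local Open Scope classical_set_scope.
Local Open Scope card_scope.

(** * Finite sequences and subsets of infinite sets *)

Lemma card_le_inj T U (A : set T) (B : set U) (f : T -> U) :
  (forall x, A x -> B (f x)) ->
  (forall x y, A x -> A y -> f x = f y -> x = y) -> A #<= B.
Proof.
move=> fAB finj.
have inj : {in A &, injective f}.
  by move=> x y /set_mem Ax /set_mem Ay; exact: finj.
rewrite -(card_le_eql (inj_card_eq inj)); apply: subset_card_le.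
by move=> _ [x Ax <-]; exact: fAB.
Qed.

Lemma card_le_ex T U (A : set T) (B : set U) : A #<= B -> B !=set0 ->
  exists f : T -> U, (forall x, A x -> B (f x)) /\
    (forall x y, A x -> A y -> f x = f y -> x = y).
Proof.
elim/Ppointed: U => U in B *; first by move=> _ [u]; have := no u.
move=> /pcard_leP[f] _; exists f; split=> [x Ax|x y Ax Ay fxy].
  exact: (@funS _ _ _ _ f).
by apply: (@inj _ _ _ f) => //; exact: mem_set.
Qed.

(** Smallest members of families of sets exist, as [card_minP] shows by Zorn's
    lemma; for a family of two sets this is comparability.  The sum type brings
    both sets into one type. *)
Lemma card_le_total T U (A : set T) (B : set U) : A #<= B \/ B #<= A.
Proof.
have [|+ Cmin] := @card_minP _ [set inl @` A; inr @` B : set (T + U)].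
  by exists (inl @` A); left.
have inlA : (inl @` A : set (T + U)) #= A.
  by apply: inj_card_eq => x y _ _ [].
have inrB : (inr @` B : set (T + U)) #= B.
  by apply: inj_card_eq => x y _ _ [].
have CA := Cmin _ (or_introl erefl); have CB := Cmin _ (or_intror erefl).
case=> E; [left; move: CB|right; move: CA]; rewrite E.
  by rewrite (card_le_eql inlA) (card_le_eqr inrB).
by rewrite (card_le_eql inrB) (card_le_eqr inlA).
Qed.

(** The empty sequence is left out so that the empty set has no sequences: the
    empty injection is then a starting point for Zorn's lemma below. *)
Definition nseqs (T : eqType) (A : set T) : set (seq T) :=
  [set l | l != [::] /\ [set` l] `<=` A].

Lemma card_le_nseqs (T U : eqType) (A : set T) (B : set U) :
  A #<= B -> nseqs A #<= nseqs B.
Proof.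
move=> AB; have [B0|/set0P B0] := eqVneq B set0.
  suff -> : nseqs A = set0 by exact: card_ge0.
  move: AB; rewrite B0 => /card_le0P ->; apply/seteqP; split=> // -[|x l] [] //=.
  by move=> _ /(_ x); apply; rewrite /= mem_head.
have [f [fAB finj]] := card_le_ex AB B0.
apply: (@card_le_inj _ _ _ _ (map f)).
  move=> l [l0 lA]; split; first by case: l l0 {lA}.
  by move=> _ /= /mapP[y yl ->]; apply/fAB/lA.
move=> l m [_ lA] [_ mA].
elim: l m lA mA => [|a l IH] [|b m] //= lA mA [ab lm].
have la : A a by apply: lA; rewrite /= mem_head.
have mb : A b by apply: mA; rewrite /= mem_head.
rewrite (finj _ _ la mb ab) (IH m) // => z zl; [apply: lA|apply: mA];
  by rewrite /= inE zl orbT.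
Qed.

(** Code x in B by the sequence [x] and x in C by [f x; f x], where f injects C
    into B: this injects the union into the sequences over B, hence into B, and
    so the sequences over the union into those over B. *)
Lemma card_nseqs_setU (T : eqType) (B C : set T) : B !=set0 ->
  nseqs B #<= B -> C #<= B -> nseqs (B `|` C) #<= B.
Proof.
move=> B0 BB CB.
apply: card_le_trans (BB); apply: card_le_nseqs; apply: card_le_trans BB.
have [f [fCB finj]] := card_le_ex CB B0.
apply: (@card_le_inj _ _ _ _
  (fun x => if x \in B then [:: x] else [:: f x; f x])).
  move=> x [Bx|Cx]; case: ifPn => [/set_mem Bx'|/negP nB]; split=> // y /=.
  - by rewrite inE => /eqP->.
  - by case: nB; exact: mem_set.
  - by rewrite inE => /eqP->.
  - by rewrite !inE orbb => /eqP->; exact: fCB.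
move=> x y; case: ifPn => [/set_mem Bx|/negP nBx];
  case: ifPn => [/set_mem By|/negP nBy] //= BCx BCy [] //.
move=> fxy _; apply: finj (fxy).
- by case: BCx => // /mem_set.
- by case: BCy => // /mem_set.
Qed.

(** An infinite set A has as many finite sequences as elements.  As in the
    classical proof that A * A has the cardinality of A, Zorn's lemma gives a
    maximal injection of the sequences over some subset B of A into B.  If A \ B
    contained a copy C of B, the injection would extend to B together with C by
    sending the new sequences into C; so A \ B is no larger than B, and A has
    the cardinality of B. *)
Section nseqs_infinite.
Variables (T : eqType) (A : set T).

(** The injection is encoded by its graph G, so that unions of chains are unions
   of sets; its set B can be read off from the sequences of length one. *)
Let base (G : set (seq T * T)) : set T := [set x | exists y, G ([:: x], y)].

Let good (G : set (seq T * T)) :=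
  [/\ forall l x y, G (l, x) -> G (l, y) -> x = y,
      forall l m x, G (l, x) -> G (m, x) -> l = m,
      forall l, nseqs (base G) l <-> exists x, G (l, x),
      base G `<=` A
    & forall l x, G (l, x) -> base G x].

Let good_card G : good G -> nseqs (base G) #<= base G.
Proof.
case=> Gf Gi Gd _ Gr.
have [->|/set0P[[|x0 ?] [//]]] := eqVneq (nseqs (base G)) set0.
  exact: card_ge0.
move=> _ _; have /choice[f fP] : forall l, exists x, nseqs (base G) l -> G (l, x).
  move=> l; have [/Gd[x Gx]|nl] := pselect (nseqs (base G) l); first by exists x.
  by exists x0.
apply: (@card_le_inj _ _ _ _ f) => [l /fP/Gr //|l m /fP lG /fP mG E].
by apply: Gi lG _; rewrite E.
Qed.

Let good_bigcup F : F `<=` good -> total_on F subset ->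
  good (\bigcup_(X in F) X).
Proof.
move=> Fgood Ftot.
have common p q : (\bigcup_(X in F) X) p -> (\bigcup_(X in F) X) q ->
    exists2 X, F X & X p /\ X q.
  move=> [X FX Xp] [Y FY Yq].
  by have [XY|YX] := Ftot _ _ FX FY; [exists Y|exists X] => //; split; auto.
have base_sub X : F X -> base X `<=` base (\bigcup_(X in F) X).
  by move=> FX x [y Xy]; exists y, X.
split.
- by move=> l x y lx /(common _ _ lx)[X /Fgood[Xf _ _ _ _] []]; exact: Xf.
- by move=> l m x lx /(common _ _ lx)[X /Fgood[_ Xi _ _ _] []]; exact: Xi.
- move=> l; split=> [[l0 lb]|[x [X FX Xx]]]; last first.
    have [_ _ /(_ l)[_ Xd] _ _] := Fgood _ FX.
    have [l0 lb] := Xd (ex_intro _ _ Xx).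
    by split=> //; apply: subset_trans (base_sub _ FX).
  (* A finite sequence over the union already lies in one member of the chain. *)
  have [X FX lX] : exists2 X, F X & [set` l] `<=` base X.
    case: l l0 lb => // a l _; elim: l a => [|b l IH] a lb.
      have [|y [X FX Xa]] := lb a; first by rewrite /= mem_head.
      by exists X => // x /=; rewrite inE => /eqP->; exists y.
    have [|y [X FX Xa]] := lb a; first by rewrite /= mem_head.
    have [|Y FY bY] := IH b; first by move=> x xl; apply: lb; rewrite /= inE xl orbT.
    have [XY|YX] := Ftot _ _ FX FY.
      exists Y => // x /=; rewrite inE => /orP[/eqP->|/bY//].
      by exists y; exact: XY.
    exists X => // x /=; rewrite inE => /orP[/eqP->|/bY[z Yz]].
      by exists y.
    by exists z; exact: YX.
  have [_ _ /(_ l)[+ _] _ _] := Fgood _ FX.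
  by case=> // x Xx; exists x, X.
- by move=> x [y [X FX Xx]]; have [_ _ _ + _] := Fgood _ FX; apply; exists y.
- move=> l x [X FX Xx]; have [_ _ _ _ Xr] := Fgood _ FX.
  exact: base_sub (Xr _ _ Xx).
Qed.

Let good_extend G C : good G -> C !=set0 -> C `<=` A `\` base G ->
  nseqs (base G `|` C) #<= C -> exists2 H, G `<` H & good H.
Proof.
move=> [Gf Gi Gd GA Gr] C0 CA /card_le_ex/(_ C0)[g [gC ginj]].
pose H := G `|` [set p | [/\ nseqs (base G `|` C) p.1,
  ~ nseqs (base G) p.1 & p.2 = g p.1]].
have GH : G `<=` H by left.
have baseH : base H = base G `|` C.
  apply/seteqP; split=> x.
    case=> y [Gx|/= [[_ /(_ x)+] _ _]]; first by left; exists y.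
    by apply; rewrite /= mem_head.
  have [|nGx [//|Cx]] := pselect (base G x); first by case=> y Gx _; exists y; left.
  exists (g [:: x]); right; split=> //=.
    by split=> // y /=; rewrite inE => /eqP->; right.
  by case=> _ /(_ x) => Bx; apply: nGx; apply: Bx; rewrite /= mem_head.
have CnG x : C x -> ~ base G x by move=> /CA[].
have dom l : nseqs (base G `|` C) l -> exists x, H (l, x).
  move=> lGC; have [lG|nlG] := pselect (nseqs (base G) l).
    by have /Gd[x Gx] := lG; exists x; left.
  by exists (g l); right.
exists H.
  split=> // HG; have [c Cc] := C0.
  have [y Hy] : base H c by rewrite baseH; right.
  by apply: (CnG c) => //; exists y; exact: HG.
have Gdom l x : G (l, x) -> nseqs (base G) l by move=> Gx; apply/Gd; exists x.
split; rewrite ?baseH.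
- move=> l x y [Gx|[/= lGC nl ->]] [Gy|[/= _ nl' ->]] //.
  + exact: Gf Gx Gy.
  + by case: nl'; exact: Gdom Gx.
  + by case: nl; exact: Gdom Gy.
- move=> l m x [Gx|[/= lGC nl xE]] [Gy|[/= mGC nm yE]] //.
  + exact: Gi Gx Gy.
  + by have := Gr _ _ Gx; rewrite yE => /CnG; case; exact: gC.
  + by have := Gr _ _ Gy; rewrite xE => /CnG; case; exact: gC.
  + by apply: ginj => //; rewrite -xE.
- move=> l; split; first exact: dom.
  by case=> x [/Gdom[l0 lG]|[] //]; split=> //; apply: subset_trans lG _ => ?; left.
- by move=> x [/GA//|/CA[]].
- by move=> l x [/Gr|[/= lGC _ ->]]; [left|right; exact: gC].
Qed.

Lemma card_nseqs_infinite : infinite_set A -> nseqs A #<= A.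
Proof.
move=> /infiniteP Ainf.
have [G [gG maxG]] := Zorn_bigcup good_bigcup.
have ext C : C !=set0 -> C `<=` A `\` base G ->
    ~ (nseqs (base G `|` C) #<= C).
  by move=> C0 CA /(good_extend gG C0 CA)[H GH]; exact: maxG.
have GA : base G `<=` A by case: gG.
have [B0|/set0P B0] := eqVneq (base G) set0.
  (* If B is empty, a countable subset of A takes the place of the copy of B. *)
  have /card_subP[C CN CA] := Ainf.
  exfalso; apply: (ext C); rewrite ?B0 ?setD0 ?set0U//.
    by apply/infinite_setN0/infiniteP; rewrite (card_le_eqr CN).
  rewrite (card_le_eqr CN); apply: (@card_le_trans _ _ _ (nseqs [set: nat])).
    by apply: card_le_nseqs; rewrite (card_le_eql CN).
  exact: countableP.
have [|/card_subP[C CB CA]] := card_le_total (A `\` base G) (base G).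
  move=> AB; have := card_nseqs_setU B0 (good_card gG) AB.
  rewrite setDUK// => H; apply: card_le_trans H (subset_card_le GA).
exfalso; apply: (ext C) => //.
  apply/set0P/eqP => C0; move: CB; rewrite C0 card_eq_sym card_eq0 => /eqP Bn.
  by case: B0 => b; rewrite Bn.
rewrite (card_le_eqr CB); apply: card_nseqs_setU => //; first exact: good_card.
by rewrite (card_le_eql CB).
Qed.

End nseqs_infinite.

Definition fsubsets T (A : set T) : set (set T) :=
  [set F | finite_set F /\ F `<=` A].

(** Every finite subset of A is enumerated by the tail of a nonempty sequence
    over A. *)
Lemma card_le_fsubsets (T U : eqType) (A : set T) (K : set U) :
  A #<= K -> infinite_set K -> fsubsets A #<= K.
Proof.
move=> AK Kinf; have [A0|/set0P[a Aa]] := eqVneq A set0.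
  have [k Kk] := infinite_setN0 Kinf.
  apply: (@card_le_inj _ _ _ _ (fun=> k)) => // F G [_ FA] [_ GA] _.
  by move: FA GA; rewrite A0 !subset0 => -> ->.
apply: card_le_trans (card_nseqs_infinite Kinf).
apply: card_le_trans (card_le_nseqs AK).
apply: card_le_trans (card_image_le (fun l => [set` behead l]) _).
apply: subset_card_le => F [/finite_seqP[l ->] lA].
exists (a :: l) => //; split=> // x /=; rewrite inE => /orP[/eqP->//|]; exact: lA.
Qed.

(** An element x of F i is determined by i, which is coded by an element of K
    since D is countable and K infinite, and by the image of x under an injection
    of F i into K: two elements of K, that is, a sequence over K. *)
Lemma card_le_bigcup I T (U : eqType) (D : set I) (F : I -> set T) (K : set U) :
  countable D -> infinite_set K -> (forall i, D i -> F i #<= K) ->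
  \bigcup_(i in D) F i #<= K.
Proof.
move=> /countable_injP[e einj] Kinf FK; have K0 := infinite_setN0 Kinf.
have [h [hK hinj]] := card_le_ex ((infiniteP _).1 Kinf) K0.
have /choice[g gP] : forall i, exists g : T -> U, D i ->
    (forall x, F i x -> K (g x)) /\
    (forall x y, F i x -> F i y -> g x = g y -> x = y).
  move=> i; have [Di|nDi] := pselect (D i); last first.
    by have [k _] := K0; exists (fun=> k).
  by have [g] := card_le_ex (FK i Di) K0; exists g.
have [->|/set0P[_ [i0 _ _]]] := eqVneq (\bigcup_(i in D) F i) set0.
  exact: card_ge0.
have /choice[c cP] : forall x, exists i, (\bigcup_(i in D) F i) x -> D i /\ F i x.
  move=> x; have [[i Di Fx]|nx] := pselect ((\bigcup_(i in D) F i) x).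
    by exists i.
  by exists i0.
apply: card_le_trans (card_nseqs_infinite Kinf).
apply: (@card_le_inj _ _ _ _ (fun x => [:: h (e (c x)); g (c x) x])).
  move=> x /cP[Di Fx]; split=> // y; rewrite /= !inE => /orP[] /eqP->.
    exact: hK.
  by have [+ _] := gP _ Di; exact.
move=> x y /cP[Dx Fx] /cP[Dy Fy] [/hinj hxy gxy].
have cxy : c x = c y by apply: einj; rewrite ?inE//; exact: hxy.
have [_ ginj] := gP _ Dx; apply: ginj => //; first by rewrite cxy.
by rewrite {2}cxy.
Qed.

(** * Cardinal bounds for so-networks *)

Lemma filter_bigcap T (I : choiceType) (D : set I) (f : I -> set T)
    (F : set_system T) : Filter F -> finite_set D ->
  (forall i, D i -> F (f i)) -> F (\bigcap_(i in D) f i).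
Proof. by move=> FF /finite_fsetP[E ->] Ff; exact: filter_bigI. Qed.

Section so_character_bounds.
Variable Y : topologicalType.
Implicit Types (y : Y) (P : set Y) (N B : set (set Y)).

(** By definition [so_char Y] is minimal only among sets of sets of points of Y;
    the bound A may live in any type.  A bound smaller than [so_char Y] has a
    copy inside [so_char Y], to which minimality applies. *)
Lemma so_char_le T (A : set T) : A !=set0 ->
  (forall y, so_char_at y #<= A) -> so_char Y #<= A.
Proof.
move=> [a Aa] leA.
have [//|/card_subP[C CA Csub]] := card_le_total (so_char Y) A.
rewrite -(card_le_eqr CA).
have [_ _ minY] := so_charP Y; apply: minY => [|y]; last first.
  by rewrite (card_le_eqr CA).
apply/set0P/eqP => C0; move: CA; rewrite C0 card_eq_sym card_eq0 => /eqP A0.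
by move: Aa; rewrite A0.
Qed.

Lemma open_seq_open P : open P -> seq_open P.
Proof.
by move=> oP y Py; split=> // u uy; apply: uy; exact: open_nbhs_nbhs.
Qed.

Lemma seq_openI P Q : seq_open P -> seq_open Q -> seq_open (P `&` Q).
Proof.
move=> sP sQ y [Py Qy]; split=> // u uy.
have [[_ /(_ _ uy) uP] [_ /(_ _ uy) uQ]] := (sP y Py, sQ y Qy).
by near=> n; split; [near: n; exact: uP|near: n; exact: uQ].
Unshelve. all: by end_near. Qed.

Lemma seq_open_bigcup I (D : set I) (P : I -> set Y) :
  (forall i, D i -> seq_open (P i)) -> seq_open (\bigcup_(i in D) P i).
Proof.
move=> sP y [i Di Pi]; split=> [|u uy]; first by exists i.
have [_ /(_ _ uy)] := sP i Di y Pi.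
by apply: filterS => n Pn; exists i.
Qed.

Lemma seq_open_bigcap (I : choiceType) (D : set I) (P : I -> set Y) :
  finite_set D -> (forall i, D i -> seq_open (P i)) ->
  seq_open (\bigcap_(i in D) P i).
Proof.
move=> Dfin sP y Py; split=> // u uy.
apply: (@filter_bigcap _ _ D (fun i => u @^-1` P i)) => // i Di.
by have [_] := sP i Di y (Py i Di); exact.
Qed.

(** A family which refines the neighbourhoods of y need not be directed; its
    finite intersections are. *)
Lemma so_network_bigcap y B :
  (forall P, B P -> seq_open P /\ P y) ->
  (forall U, open U -> U y -> exists2 P, B P & P `<=` U) ->
  so_network y [set \bigcap_(P in F) P | F in fsubsets B].
Proof.
move=> Bso Bref; split.
- move=> _ [F [Ffin FB] <-]; split; last by move=> P /FB/Bso[].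
  by apply: seq_open_bigcap => // P /FB/Bso[].
- move=> _ _ [F [Ffin FB] <-] [G [Gfin GB] <-].
  exists (\bigcap_(P in F `|` G) P); last by rewrite bigcap_setU.
  exists (F `|` G) => //; split; first by rewrite finite_setU.
  by move=> P [/FB|/GB].
- move=> U oU Uy; have [P BP PU] := Bref U oU Uy.
  exists P => //; exists [set P]; last by rewrite bigcap_set1.
  by split=> // _ ->.
Qed.

Lemma so_char_at_le_subnetwork (T : eqType) (K : set T) y B :
  infinite_set K -> B #<= K ->
  (forall P, B P -> seq_open P /\ P y) ->
  (forall U, open U -> U y -> exists2 P, B P & P `<=` U) ->
  so_char_at y #<= K.
Proof.
move=> Kinf BK Bso Bref; have [_ minN] := so_char_atP y.
apply: card_le_trans (minN _ (so_network_bigcap Bso Bref)) _.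
exact: card_le_trans (card_image_le _ _) (card_le_fsubsets BK Kinf).
Qed.

(** A finite directed family has a smallest member, and a member contained in all
    neighbourhoods of y is {y} in a Hausdorff space. *)
Lemma seq_open_set1 y : hausdorff_space Y -> finite_set (so_char_at y) ->
  seq_open [set y].
Proof.
move=> hY Nfin; have [[Nso Ndir Nref] _] := so_char_atP y.
have [Q NQ Qmin] : exists2 Q, so_char_at y Q &
    forall P, so_char_at y P -> Q `<=` P.
  have [l lE] := (finite_seqP _).1 Nfin.
  suff [Q NQ Qmin] : exists2 Q, so_char_at y Q & forall P, P \in l ->
      so_char_at y P -> Q `<=` P.
    by exists Q => // P NP; apply: Qmin => //; move: (NP); rewrite {1}lE.
  elim: l {lE} => [|P l [Q NQ Qmin]].
    by have [Q NQ _] := Nref setT openT I; exists Q.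
  have [NP|nNP] := pselect (so_char_at y P); last first.
    by exists Q => // R; rewrite inE => /orP[/eqP->//|]; exact: Qmin.
  have [W NW WPQ] := Ndir P Q NP NQ.
  exists W => // R; rewrite inE => /orP[/eqP-> _|Rl NR] x /WPQ[] //.
  by move=> _; exact: Qmin.
suff <- : Q = [set y] by have [] := Nso Q NQ.
apply/seteqP; split=> [x Qx|_ ->]; last by have [] := Nso Q NQ.
apply: contrapT => /eqP xy; move: hY; rewrite open_hausdorff.
move=> /(_ _ _ xy)[[U V] [/= /set_mem Ux /set_mem Vy] [oU oV /eqP UV0]].
have [P NP PV] := Nref V oV Vy.
have : (U `&` V) x by split=> //; apply: PV; exact: Qmin Qx.
by rewrite UV0.
Qed.

End so_character_bounds.

(** * Finite unions of convergent sequences *)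

Section convergent_sequence_unions.
Variable X : topologicalType.
Implicit Types (S T W : set X).

Lemma countable_fin_union_seqs S :
  fin_union_convergent_sequences S -> countable S.
Proof.
case=> n [A [Aseq ->]]; apply: bigcup_countable => [|i _].
  exact: finite_set_countable.
have [u [x [_ ->]]] := Aseq i.
rewrite -bigcup2E; apply: bigcup_countable; first exact: countableP.
move=> [|[|j]] _ /=; last exact: countable0.
  exact: card_le_trans (card_image_le _ _) (countableP _).
exact: countable1.
Qed.

(** Compactness of a finite union of convergent sequences, for sequential
    neighbourhoods instead of open ones: a sequential neighbourhood of the limit
    x of u misses only finitely many of the u k. *)
Lemma fin_union_seqs_finite_cover S (P : X -> set X) :
  fin_union_convergent_sequences S -> (forall a, S a -> seq_nbhd (P a) a) ->
  exists2 E, finite_set E /\ E `<=` S & S `<=` \bigcup_(a in E) P a.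
Proof.
case=> n [A [Aseq ->]] Pnbhd.
have /choice[E EP] : forall i, exists E, [/\ finite_set E, E `<=` A i &
    A i `<=` \bigcup_(a in E) P a].
  move=> i; have [u [x [ux AE]]] := Aseq i.
  have xA : A i x by rewrite AE; right.
  have uA k : A i (u k) by rewrite AE; left; exists k.
  have PA a : A i a -> P a a by move=> Aa; case: (Pnbhd a) => //; exists i.
  have [|_ /(_ u ux) [N _ uN]] := Pnbhd x; first by exists i.
  exists ([set x] `|` u @` `I_N); split.
  - by rewrite finite_setU; split => //; exact: finite_image.
  - by move=> _ [->|[k _ <-]].
  - move=> a; rewrite AE => -[[k _ <-]|->]; last by exists x; [left|exact: PA].
    have [Nk|kN] := leqP N k; first by exists x; [left|exact: uN].
    by exists (u k); [right; exists k|exact: PA].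
exists (\bigcup_i E i).
  split; first by apply: bigcup_finite => // i _; case: (EP i).
  by move=> a [i _ Ea]; exists i => //; case: (EP i) => _ + _; exact.
move=> a [i _ Aa]; have [_ _ /(_ a Aa)[b Eb Pba]] := EP i.
by exists b => //; exists i.
Qed.

Lemma fin_union_seqs_nat_subcover S (G : nat -> set X) :
  fin_union_convergent_sequences S -> (forall j, open (G j)) ->
  S `<=` \bigcup_j G j -> exists m, S `<=` \bigcup_(j in `I_m) G j.
Proof.
move=> Sfin oG SG.
have /choice[i iP] : forall a, exists i, S a -> G i a.
  move=> a; have [/SG[i _ Ga]|nSa] := pselect (S a); first by exists i.
  by exists 0%N.
have [|E [Efin ES] SE] := @fin_union_seqs_finite_cover S (G \o i) Sfin.
  by move=> a /iP; exact/open_seq_open/oG.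
have [M EM] : exists M, forall a, E a -> (i a < M)%N.
  have [l lE] := (finite_seqP _).1 Efin.
  exists (\max_(a <- l) i a).+1 => a; rewrite lE ltnS /= => al.
  exact: (@leq_bigmax_seq _ l xpredT i a al isT).
by exists M => a /SE[b Eb Gb]; exists (i b) => //; exact: EM.
Qed.

(** The heart of the proof.  If the D n shrink to T and are disjoint from the
    sequentially open set W, then no point t of T in W is a limit point of the
    D n.  Otherwise open sets Q_0, Q_1, ... around t, the j-th one separating t
    from the j-th point of T, allow the choice of points s k of D (n_k), with
    n_k >= k, in the intersection of the Q_j with j < k.  This sequence converges
    to t: given an open O around t, the set T is covered by O and finitely many
    of the open sets opposite to the Q_j; the points s k lie in this cover for
    large k, and have then left each of those opposite sets.  So s k is in W for
    large k, a contradiction. *)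
Lemma seq_open_avoid T W t (D : nat -> set X) : hausdorff_space X ->
  fin_union_convergent_sequences T -> seq_open W -> T t -> W t ->
  (forall n, D n `<=` ~` W) ->
  (forall O, open O -> T `<=` O -> \forall n \near \oo, D n `<=` O) ->
  exists V, [/\ open V, V t & \forall n \near \oo, D n `<=` ~` V].
Proof.
move=> hX Tfin sW Tt Wt DW Dto; apply: contrapT => nV.
have freq V k : open V -> V t -> exists p, [/\ (k <= p.1)%N, D p.1 p.2 & V p.2].
  move=> oV Vt; apply: contrapT => nD; apply: nV; exists V; split=> //.
  by exists k => // n /= kn x Dx Vx; apply: nD; exists (n, x).
have /countable_injP[e einj] := countable_fin_union_seqs Tfin.
(* The first component of Q j is a neighbourhood of t, the second one a
   neighbourhood of the point of T numbered j by e, if there is one other than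
   t. *)
have /choice[Q QP] : forall j, exists Q : set X * set X,
    [/\ open Q.1, open Q.2, Q.1 t, Q.1 `&` Q.2 = set0 &
      forall a, T a -> a != t -> e a = j -> Q.2 a].
  move=> j; have [[a [Ta aNt ea]]|na] :=
      pselect (exists a, [/\ T a, a != t & e a = j]); last first.
    exists (setT, set0); split=> //=; [exact: openT|exact: open0| |].
      by rewrite setI0.
    by move=> a Ta aNt ea; case: na; exists a.
  move: hX; rewrite open_hausdorff => /(_ _ _ aNt).
  move=> [[U V] [/= /set_mem Ua /set_mem Vt] [oU oV /eqP UV0]].
  exists (V, U); split=> //=; first by rewrite setIC.
  move=> b Tb _ eb; suff -> : b = a by [].
  by apply: einj; rewrite ?inE ?ea.
(* p k is the pair of n_k and s k. *)
have /choice[p pP] : forall k, exists p, [/\ (k <= p.1)%N, D p.1 p.2 &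
    (\bigcap_(j in `I_k) (Q j).1) p.2].
  move=> k; apply: freq; last by move=> j _; case: (QP j).
  rewrite openE => x Vx; apply: filter_bigcap => // j jk.
  by apply: open_nbhs_nbhs; split; [case: (QP j)|exact: Vx].
have st : (fun k => (p k).2) @ \oo --> t.
  move=> U; rewrite nbhsE => -[O [oO Ot] OU].
  (* The cover of T by O and the second components, shifted by one. *)
  pose G j := if j is i.+1 then (Q i).2 else O.
  have [|a Ta|m TG] := @fin_union_seqs_nat_subcover T G Tfin.
  - by move=> [//|j]; case: (QP j).
  - have [->|aNt] := eqVneq a t; first by exists 0%N.
    by exists (e a).+1 => //; case: (QP (e a)) => _ _ _ _; exact.
  have [|N _ DN] := Dto _ _ TG.
    by apply: bigcup_open => -[//|j] _; case: (QP j).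
  exists (maxn N m) => // k; rewrite /= geq_max => /andP[Nk mk].
  have [kp Dp Qp] := pP k.
  have [[|j] jm /= Gj] := DN _ (leq_trans Nk kp) _ Dp; first exact: OU.
  have [_ _ _ Q0 _] := QP j.
  suff : ((Q j).1 `&` (Q j).2) (p k).2 by rewrite Q0.
  split=> //; apply: Qp; rewrite /=; exact: leq_trans (ltnW jm) mk.
have [_ /(_ _ st)[N _ WN]] := sW t Wt.
have [_ Dp _] := pP N.
by apply: (DW _ _ Dp); exact: (WN N (leqnn N)).
Qed.

End convergent_sequence_unions.

(** * Sequentially open sets in the Vietoris topology *)

Section vietoris_sets.
Variable X : topologicalType.
Implicit Types (S T : seqhyper X) (W : set X) (F : set (set X)).

Definition subset_of W : set (seqhyper X) := [set S : seqhyper X | S `<=` W].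

Definition meeting W : set (seqhyper X) :=
  [set S : seqhyper X | (S `&` W) !=set0].

(** The Vietoris set of a family of sets which need be neither open nor indexed:
    the network at S is indexed by finite sets of sets, whose number can be
    bounded. *)
Definition vietoris_of F : set (seqhyper X) :=
  subset_of (\bigcup_(W in F) W) `&` \bigcap_(W in F) meeting W.

Lemma vietorisE r (U : 'I_r -> set X) : vietoris U = vietoris_of (range U).
Proof.
apply/seteqP; split=> S [SU SUj]; split.
- by move=> x /SU[j _ Ux]; exists (U j) => //; exists j.
- by move=> _ [j _ <-]; exact: SUj.
- by move=> x /SU[_ [j _ <-] Ux]; exists j.
- by move=> j; apply: SUj; exists j.
Qed.

Lemma open_vietoris r (U : 'I_r -> set X) :
  (forall i, open (U i)) -> open (vietoris U).
Proof.
move=> oU; exists [set vietoris U]; last by rewrite bigcup_set1.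
by move=> _ ->; exists r, U.
Qed.

Lemma vietoris_nbhs (B : set (seqhyper X)) S : open B -> B S ->
  exists r (U : 'I_r -> set X),
    [/\ forall i, open (U i), vietoris U S & vietoris U `<=` B].
Proof.
move=> [D Dbase <-] [V DV VS].
have [r [U [oU VE]]] := Dbase V DV.
by exists r, U; rewrite -VE; split=> // T VT; exists V.
Qed.

Lemma open_subset_of W : open W -> open (subset_of W).
Proof.
move=> oW; suff -> : subset_of W = vietoris (fun _ : 'I_1 => W).
  exact: open_vietoris.
apply/seteqP; split=> [S SW|S [SW _] x /SW[]//].
have [x Sx] := seqhyper_neq0 S; split=> [y /SW Wy|_].
  by exists ord0.
by exists x; split=> //; exact: SW.
Qed.

Lemma near_subset_of (u : nat -> seqhyper X) S W :
  u @ \oo --> S -> open W -> (S : set X) `<=` W ->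
  \forall n \near \oo, u n `<=` W.
Proof.
move=> uS oW SW; apply: (uS (subset_of W)); apply: open_nbhs_nbhs.
by split=> //; exact: open_subset_of.
Qed.

Lemma open_meeting W : open W -> open (meeting W).
Proof.
move=> oW.
suff -> : meeting W = vietoris (fun i : 'I_2 => if i == ord0 then W else setT).
  by apply: open_vietoris => i; case: ifP => // _; exact: openT.
apply/seteqP; split=> [S [x [Sx Wx]]|S [_ /(_ ord0)]]; last by rewrite eqxx.
split=> [y _|j]; first by exists ord_max.
by exists x; split=> //; case: ifP.
Qed.

Hypothesis hX : hausdorff_space X.

(** If infinitely many u n missed W, these would be sets shrinking to S and
    disjoint from W, so that they would avoid a neighbourhood V of a point t of S
    in W; but almost all u n meet V.  The set D n is u n when u n misses W, and
    is empty otherwise. *)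
Lemma seq_open_meeting W : seq_open W -> seq_open (meeting W).
Proof.
move=> sW S [t [St Wt]]; split=> [|u uS]; first by exists t.
pose D n := [set x | (u n : set X) x /\ ~ meeting W (u n)].
have [| |V [oV Vt DV]] :=
    @seq_open_avoid X S W t D hX (seqhyper_fin S) sW St Wt.
- by move=> n x [unx nm] Wx; apply: nm; exists x.
- move=> O oO SO; have := near_subset_of uS oO SO.
  by apply: filterS => n uO x [/uO].
have : \forall n \near \oo, meeting V (u n).
  apply: (uS (meeting V)); apply: open_nbhs_nbhs.
  by split; [exact: open_meeting|exists t].
apply: filterS2 DV => n DV [x [ux Vx]].
by apply: contrapT => nm; exact: (DV x).
Qed.

(** The sets D n of points of u n outside W shrink to S.  Each point of S has an
    open neighbourhood avoided by almost all of them; finitely many of these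
    neighbourhoods cover S, so their union contains almost all D n and is avoided
    by almost all D n: almost all D n are empty. *)
Lemma seq_open_subset_of W : seq_open W -> seq_open (subset_of W).
Proof.
move=> sW S SW; split=> // u uS.
pose D n := (u n : set X) `\` W.
have Dto O : open O -> (S : set X) `<=` O -> \forall n \near \oo, D n `<=` O.
  move=> oO SO; have := near_subset_of uS oO SO.
  by apply: filterS => n uO x [/uO].
have /choice[V VP] : forall t, exists V, (S : set X) t ->
    [/\ open V, V t & \forall n \near \oo, D n `<=` ~` V].
  move=> t; have [St|nSt] := pselect ((S : set X) t); last by exists setT.
  have [| |V VP] :=
      @seq_open_avoid X S W t D hX (seqhyper_fin S) sW St (SW t St).
  - by move=> n x [].
  - exact: Dto.
  - by exists V.
have [|E [Efin ES] SE] :=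
    @fin_union_seqs_finite_cover X S V (seqhyper_fin S).
  by move=> a /VP[oV Va _]; exact: open_seq_open.
have DE : \forall n \near \oo, D n `<=` \bigcup_(a in E) V a.
  by apply: Dto => //; apply: bigcup_open => a /ES/VP[].
have DnE : \forall n \near \oo,
    (\bigcap_(a in E) [set n | D n `<=` ~` V a]) n.
  by apply: filter_bigcap => // a /ES/VP[].
apply: filterS2 DE DnE => n DE DnE x ux; apply: contrapT => nWx.
by have [//|a ae Vx] := DE x; exact: (DnE a ae x).
Qed.

Lemma seq_open_vietoris_of F : finite_set F ->
  (forall W, F W -> seq_open W) -> seq_open (vietoris_of F).
Proof.
move=> Ffin sF; apply: seq_openI.
  by apply: seq_open_subset_of; exact: seq_open_bigcup.
by apply: seq_open_bigcap => // W FW; apply/seq_open_meeting/sF.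
Qed.

(** The finite set F consists of members of the networks that cover S, each inside
    some U i, and of one member inside U j for each j. *)
Lemma vietoris_of_refine S (N : X -> set (set X)) r (U : 'I_r -> set X) :
  (forall a, (S : set X) a -> so_network a (N a)) ->
  (forall i, open (U i)) -> vietoris U S ->
  exists2 F, fsubsets (\bigcup_(a in (S : set X)) N a) F &
    vietoris_of F S /\ vietoris_of F `<=` vietoris U.
Proof.
move=> NS oU [SU SUj].
have /choice[P PP] : forall a, exists P, (S : set X) a ->
    N a P /\ exists i, P `<=` U i.
  move=> a; have [Sa|nSa] := pselect ((S : set X) a); last by exists setT.
  have [i _ Ua] := SU a Sa; have [_ _ /(_ _ (oU i) Ua)[P NP PU]] := NS a Sa.
  by exists P => _; split=> //; exists i.
have /choice[Q QP] : forall j, exists Q, [/\ (\bigcup_(a in (S : set X)) N a) Q,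
    meeting Q S & Q `<=` U j].
  move=> j; have [a [Sa Ua]] := SUj j.
  have [Nso _ /(_ _ (oU j) Ua)[Q NQ QU]] := NS a Sa.
  exists Q; split=> //; first by exists a.
  by exists a; split=> //; have [] := Nso Q NQ.
have [|E [Efin ES] SE] :=
    @fin_union_seqs_finite_cover X S P (seqhyper_fin S).
  move=> a Sa; have [NP _] := PP a Sa; have [Nso _ _] := NS a Sa.
  by have [sP Pa] := Nso _ NP; exact: sP.
exists (P @` E `|` range Q); first split.
- by rewrite finite_setU; split; exact: finite_image.
- move=> _ [[a Ea <-]|[j _ <-]]; last by case: (QP j).
  by have Sa := ES a Ea; exists a => //; case: (PP a Sa).
- split; [split|move=> T TF; split].
  + by move=> x /SE[a Ea Px]; exists (P a) => //; left; exists a.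
  + move=> _ [[a Ea <-]|[j _ <-]]; last by case: (QP j).
    exists a; split; first exact: ES.
    have Sa := ES a Ea; have [NP _] := PP a Sa; have [Nso _ _] := NS a Sa.
    by have [] := Nso _ NP.
  + move=> x; case: TF => TF _ /TF[_ [[a Ea <-]|[j _ <-]] Wx].
      by have [_ [i PU]] := PP a (ES a Ea); exists i => //; exact: PU.
    by exists j => //; have [_ _ QU] := QP j; exact: QU.
  + move=> j; have [_ /(_ (Q j))[|x [Tx Qx]]] := TF.
      by right; exists j.
    by exists x; split=> //; have [_ _ QU] := QP j; exact: QU.
Qed.
End vietoris_sets.

(** * Comparison of the so-characters *)

Section comparison.
Variable X : topologicalType.

Lemma fin_union_seqs_set1 (x : X) : fin_union_convergent_sequences [set x].
Proof.
exists 1%N, (fun=> [set x]); split=> [_|].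
  exists (fun=> x), x; split; first exact: cvg_cst.
  by apply/seteqP; split=> [_ ->|_ [[k _ <-]|->]//]; right.
by apply/seteqP; split=> [_ ->|y [] //]; exists ord0.
Qed.

Definition seqhyper1 (x : X) : seqhyper X :=
  SeqHyper (ex_intro _ x erefl) (fin_union_seqs_set1 x).

Lemma seqhyper1_continuous : continuous seqhyper1.
Proof.
move=> x B; rewrite nbhsE => -[O [oO Ox] OB].
have [r [U [oU [xU xUj] UO]]] := vietoris_nbhs oO Ox.
have : \forall y \near x, (\bigcap_(j in [set: 'I_r]) U j) y.
  apply: filter_bigcap => [|j _]; first exact: finite_finset.
  apply: open_nbhs_nbhs; split=> //.
  by have [_ [->]] := xUj j.
apply: filterS => y yU; apply/OB/UO; split=> [_ ->|j].
  by have [j _ _] := xU x erefl; exists j => //; exact: yU.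
by exists y; split=> //; exact: yU.
Qed.

Lemma seqhyper_inj (S T : seqhyper X) : (S : set X) = T -> S = T.
Proof.
case: S T => S S0 Sf [T T0 Tf] /= ST; move: S0 Sf; rewrite ST => S0 Sf.
by rewrite (Prop_irrelevance S0 T0) (Prop_irrelevance Sf Tf).
Qed.

Lemma so_char_at_seqhyper1 x : so_char_at x #<= so_char_at (seqhyper1 x).
Proof.
have [[Nso Ndir Nref] _] := so_char_atP (seqhyper1 x).
have [_ minN] := so_char_atP x.
apply: card_le_trans (card_image_le (preimage seqhyper1) _).
apply: minN; split.
- move=> _ [P /Nso[sP Px] <-]; split=> // y Py; split=> // u uy.
  have [_ /(_ (seqhyper1 \o u))] := sP _ Py; apply.
  apply: (cvg_comp u seqhyper1 uy); exact: seqhyper1_continuous.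
- move=> _ _ [P NP <-] [Q NQ <-]; have [R NR RPQ] := Ndir P Q NP NQ.
  by exists (seqhyper1 @^-1` R); [exists R|move=> y /RPQ].
- move=> U oU Ux; have [|P NP PU] := Nref _ (open_subset_of oU).
    by move=> _ ->.
  by exists (seqhyper1 @^-1` P); [exists P|move=> y /PU/(_ y erefl)].
Qed.

Hypothesis hX : hausdorff_space X.
Implicit Type S : seqhyper X.

(** When each family {{a}} is an so-network at a, refining by them
    produces a Vietoris set of finitely many singletons that contains S, and S is
    its only element. *)
Lemma seq_open_seqhyper_set1 S : (forall a : X, seq_open [set a]) ->
  seq_open [set S].
Proof.
move=> s1.
have N1 a : (S : set X) a -> so_network a [set [set a]].
  move=> _; split.
  - by move=> _ ->; split=> //; exact: s1.
  - by move=> _ _ -> ->; exists [set a] => // x; split.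
  - by move=> U oU Ua; exists [set a] => // _ ->.
have ST : vietoris (fun _ : 'I_1 => setT) S.
  have [x Sx] := seqhyper_neq0 S.
  by split=> [y _|_]; [exists ord0|exists x].
have [F [Ffin FS] [VFS _]] := vietoris_of_refine N1 (fun=> openT) ST.
suff <- : vietoris_of F = [set S].
  by apply: seq_open_vietoris_of => // W /FS[a _ ->].
have sub W : F W -> exists2 a, (S : set X) a & W = [set a].
  by move=> /FS[a Sa ->]; exists a.
have [SF _] := VFS.
apply/seteqP; split=> [T [TF TFj]|_ -> //].
apply: seqhyper_inj.
apply/seteqP; split=> x.
  by move=> /TF[W /sub[a Sa ->] ->].
move=> /SF[W FW Wx]; have [a Sa WE] := sub W FW.
by have [y [Ty Wy]] := TFj W FW; move: Wx Wy Ty; rewrite WE => -> ->.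
Qed.

Lemma so_char_at_seqhyper_le S : so_char_at S #<= so_char X.
Proof.
have [C0 leC _] := so_charP X.
have [Cfin|Cinf] := pselect (finite_set (so_char X)).
  have sS : seq_open [set S].
    apply: seq_open_seqhyper_set1 => a; apply: seq_open_set1 => //.
    exact: card_le_finite (leC a) Cfin.
  have [_ minN] := so_char_atP S.
  apply: card_le_trans (minN [set [set S]] _) _; last first.
    have [c Cc] := C0.
    by apply: (@card_le_inj _ _ _ _ (fun=> c)) => // ? ? -> ->.
  split.
  + by move=> _ ->.
  + by move=> _ _ -> ->; exists [set S] => // T; split.
  + by move=> U oU US; exists [set S] => // _ ->.
pose N := \bigcup_(a in (S : set X)) so_char_at a.
have NS a : (S : set X) a -> so_network a (so_char_at a).
  by move=> _; have [] := so_char_atP a.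
pose B := [set vietoris_of F | F in fsubsets N] `&` [set V | V S].
apply: (@so_char_at_le_subnetwork _ _ _ _ B Cinf).
- apply: card_le_trans (subset_card_le _) _; first exact: subIsetl.
  apply: card_le_trans (card_image_le _ _) _; apply: card_le_fsubsets => //.
  apply: card_le_bigcup => //.
  exact: countable_fin_union_seqs (seqhyper_fin S).
- move=> _ [[F [Ffin FN] <-] FS]; split=> //.
  apply: seq_open_vietoris_of => // W /FN[a Sa NW].
  by have [/(_ W NW)[]] := NS a Sa.
- move=> O oO OS; have [r [U [oU US UO]]] := vietoris_nbhs oO OS.
  have [F FN [FS FU]] := vietoris_of_refine NS oU US.
  by exists (vietoris_of F); [split=> //; exists F|exact: subset_trans FU UO].
Qed.

End comparison.

Theorem theorem4p15 (X : topologicalType) (hX : hausdorff_space X) :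
  so_char X #= so_char (seqhyper X).
Proof.
have [X0 leX _] := so_charP X; have [S0 leS _] := so_charP (seqhyper X).
rewrite card_eq_le; apply/andP; split; apply: so_char_le => //.
  by move=> x; apply: card_le_trans (so_char_at_seqhyper1 x) (leS _).
by move=> S; exact: so_char_at_seqhyper_le.
Qed.
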